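(* Let $\lambda,\gamma>0$, let $f_0:\mathbb{R}\to[0,\infty)$ and $g_0:\mathbb{R}^2\to[0,\infty)$ be measurable with $$\int_{\mathbb{R}}(1+\varphi^2)f_0\,\mathrm{d}\varphi<\infty,\qquad \int_{\mathbb{R}^2}(1+\varphi^2)g_0\,\mathrm{d}\varphi\,\mathrm{d}\varphi_*<\infty,\qquad g_0(\varphi,\varphi_* )=g_0(\varphi_*,\varphi),$$ and let $M:=\int_{\mathbb{R}}f_0\,\mathrm{d}\varphi+2\int_{\mathbb{R}^2}g_0\,\mathrm{d}\varphi\,\mathrm{d}\varphi_*>0$. Let $M_f$ and $I_f$ be given by solving, on $[0,\infty)$, $$\dot M_f=2\gamma M_g-2\lambda M_f^2,\qquad \dot M_g=\lambda M_f^2-\gamma M_g,$$ $$\dot I_f=2\gamma I_g-2\lambda I_fM_f,\qquad \dot I_g=\lambda I_fM_f-\gamma I_g,$$ with the initial values determined by $f_0,g_0$ as in the context, and let $\varphi_\infty:=I/M$ with $I$ as in the context. Then there exist constants $C,\mu>0$ such that the solution $(V_f,V_g,\bar V_g)$ of the linear ODE system $$\dot V_f=2\gamma V_g-2\lambda M_fV_f,$$ $$\dot V_g=\lambda M_fV_f-\gamma V_g-\bar V_g,$$ $$\dot{\bar V}_g=2\lambda M_fV_f-(2+\gamma)\bar V_g+2\lambda(I_f-\varphi_\infty M_f)^2,$$ with the initial values determined by $f_0,g_0$ as in the context, satisfies $$V_f(t)+V_g(t)+\bar V_g(t)\le Ce^{-\mu t},\qquad t\ge 0.$$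
   Context: The initial values are $M_f(0)=\int_{\mathbb{R}}f_0\,\mathrm{d}\varphi$, $M_g(0)=\int_{\mathbb{R}^2}g_0\,\mathrm{d}\varphi\,\mathrm{d}\varphi_*$, $I_f(0)=\int_{\mathbb{R}}\varphi f_0\,\mathrm{d}\varphi$, $I_g(0)=\int_{\mathbb{R}^2}\varphi g_0\,\mathrm{d}\varphi\,\mathrm{d}\varphi_*$, and $I:=I_f(0)+2I_g(0)$, $\varphi_\infty=I/M$; further $V_f(0)=\int_{\mathbb{R}}(\varphi-\varphi_\infty)^2f_0\,\mathrm{d}\varphi$, $V_g(0)=\int_{\mathbb{R}^2}(\varphi-\varphi_\infty)^2g_0\,\mathrm{d}\varphi\,\mathrm{d}\varphi_*$, $\bar V_g(0)=\int_{\mathbb{R}^2}(\varphi-\varphi_* )^2g_0\,\mathrm{d}\varphi\,\mathrm{d}\varphi_*$. The statement concerns the solutions of the ODE systems displayed in the claim, with these initial values. *)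

(* Defs.v *)
From HB Require Import structures.
From mathcomp Require Import all_boot all_order all_algebra.
From mathcomp Require Import all_classical all_reals all_analysis.

Set Implicit Arguments.
Unset Strict Implicit.
Unset Printing Implicit Defensive.

Import Order.TTheory GRing.Theory Num.Theory.
Import numFieldNormedType.Exports.

Local Open Scope classical_set_scope.
Local Open Scope ring_scope.

(* Differentiability relative to the closed half-line: the two-sided derivative
   for t > 0, the right derivative at t = 0. *)
Definition is_derive_half_line (R : realType) (y : R -> R) (t l : R) : Prop :=
  (y s - y t) / (s - t) @[s --> within `[0, +oo[ t^'] --> l.

Definition solves_half_line (R : realType) (y F : R -> R) : Prop :=
  forall t, 0 <= t -> is_derive_half_line y t (F t).

Section InitialData.
Context (R : realType).
Notation mu := (@lebesgue_measure R).
Notation mu2 := (mu \x mu)%E.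

(* Densities are Borel measurable. *)
Definition admissible_f (f0 : R -> R) : Prop :=
  [/\ measurable_fun [set: R] f0,
      forall x, 0 <= f0 x
    & (\int[mu]_x ((1 + x ^+ 2) * f0 x)%:E < +oo)%E].

Definition admissible_g (g0 : R * R -> R) : Prop :=
  [/\ measurable_fun [set: R * R] g0,
      forall z, 0 <= g0 z,
      (\int[mu2]_z ((1 + z.1 ^+ 2) * g0 z)%:E < +oo)%E
    & forall x y, g0 (x, y) = g0 (y, x)].

Definition Mf0 (f0 : R -> R) : R := \int[mu]_x f0 x.
Definition Mg0 (g0 : R * R -> R) : R := \int[mu2]_z g0 z.
Definition If0 (f0 : R -> R) : R := \int[mu]_x (x * f0 x).
Definition Ig0 (g0 : R * R -> R) : R := \int[mu2]_z (z.1 * g0 z).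

Definition mass (f0 : R -> R) (g0 : R * R -> R) : R := Mf0 f0 + 2 * Mg0 g0.
Definition phi_inf (f0 : R -> R) (g0 : R * R -> R) : R :=
  (If0 f0 + 2 * Ig0 g0) / mass f0 g0.

Definition Vf0 (f0 : R -> R) (g0 : R * R -> R) : R :=
  \int[mu]_x ((x - phi_inf f0 g0) ^+ 2 * f0 x).
Definition Vg0 (f0 : R -> R) (g0 : R * R -> R) : R :=
  \int[mu2]_z ((z.1 - phi_inf f0 g0) ^+ 2 * g0 z).
Definition Vbarg0 (g0 : R * R -> R) : R :=
  \int[mu2]_z ((z.1 - z.2) ^+ 2 * g0 z).

End InitialData.

Section Systems.
Context (R : realType) (lambda gamma : R).

Definition mass_system (Mf Mg : R -> R) : Prop :=
  solves_half_line Mf (fun t => 2 * gamma * Mg t - 2 * lambda * Mf t ^+ 2) /\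
  solves_half_line Mg (fun t => lambda * Mf t ^+ 2 - gamma * Mg t).

Definition moment_system (Mf If Ig : R -> R) : Prop :=
  solves_half_line If (fun t => 2 * gamma * Ig t - 2 * lambda * If t * Mf t) /\
  solves_half_line Ig (fun t => lambda * If t * Mf t - gamma * Ig t).

Definition variance_system (phi : R) (Mf If Vf Vg Vbarg : R -> R) : Prop :=
  [/\ solves_half_line Vf (fun t => 2 * gamma * Vg t - 2 * lambda * Mf t * Vf t),
      solves_half_line Vg
        (fun t => lambda * Mf t * Vf t - gamma * Vg t - Vbarg t)
    & solves_half_line Vbarg
        (fun t => 2 * lambda * Mf t * Vf t - (2 + gamma) * Vbarg t
                  + 2 * lambda * (If t - phi * Mf t) ^+ 2)].

End Systems.

(* Main.v *)
Require Import Defs.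
From mathcomp Require Import all_boot all_order all_algebra.
From mathcomp Require Import all_classical all_reals all_analysis.
From mathcomp Require Import ring lra.
Import Order.TTheory GRing.Theory Num.Theory.
Import numFieldNormedType.Exports.
Local Open Scope classical_set_scope.
Local Open Scope ring_scope.

Set Implicit Arguments.
Unset Strict Implicit.

(** The three-dimensional variance system hides a decoupled combination.
Writing q = Vg - Vbarg / 2, one finds q' = - gamma q - lambda u ^ 2 with
u = If - phi Mf, so Vbarg = 2 (Vg - q) can be eliminated.  What remains is a
planar linear system for (Vf, Vg), with coefficient a = lambda Mf depending on
time and with forcing q.

The data of this planar system are under control.  The quantities Mf + 2 Mg = M
and If + 2 Ig = phi M are conserved, which closes the equations:
 - Mf' = gamma (M - Mf) - 2 lambda Mf ^ 2 keeps Mf nonnegative and drives it to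
   the positive zero m of the right-hand side at rate gamma
   ([riccati_nonneg], [riccati_converges]);
 - u' = - (gamma + 2 lambda Mf) u, so u, and then q, is O(exp (- gamma t))
   ([exp_decay], [forced_decay]).

For the limit coefficient al = lambda m, the weights of the energy
E = al Vf ^ 2 + 2 gamma Vg ^ 2 make the two cross terms equal, and E' becomes
  - 4 (al Vf - gamma Vg) ^ 2 - 8 gamma Vg ^ 2 + 8 gamma q Vg + (a - al) (...),
in which the last parenthesis is quadratic in (Vf, Vg).  Hence
E' <= (- rho + H exp (- gamma t)) E + O(exp (- 2 gamma t)), and since
H exp (- gamma t) is integrable on the half-line, E decays exponentially
([energy_decay]).  Finally Vf + Vg + Vbarg = Vf + 3 Vg - 2 q.  Working with
squares makes the signs of Vf, Vg and Vbarg irrelevant.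

Every estimate is a comparison with an explicit supersolution, and every
comparison is an instance of one principle, [nonneg_solution]: a function that
starts nonnegative and satisfies y' >= K y wherever y < 0 stays nonnegative. *)

(** * Derivatives relative to the closed half-line *)

Lemma is_derive_half_line_total (R : realType) (y : R -> R) (t l : R) :
  is_derive t 1 y l -> is_derive_half_line y t l.
Proof.
move=> [ydrv <-]; rewrite /is_derive_half_line.
apply: (@cvg_trans _ ((y s - y t) / (s - t) @[s --> t^'])).
  by apply: cvg_app; exact: cvg_within.
have shiftP : (fun s => s - t) s @[s --> t^'] --> (0 : R)^'.
  move=> P /nbhs_ballP[e /= e0 eP]; apply/nbhs_ballP; exists e => //= s.
  rewrite /ball /= => tse st; apply: eP; last by rewrite subr_eq0.
  by rewrite /ball /= sub0r opprB.
have := cvg_comp _ _ shiftP ydrv.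
apply: cvg_trans; apply: near_eq_cvg; near=> s.
by rewrite /= /GRing.scale /= mulr1 subrK mulrC.
Unshelve. all: by end_near.
Qed.

Lemma half_line_cst (R : realType) (k t : R) :
  is_derive_half_line (fun=> k) t 0.
Proof. by apply: is_derive_half_line_total; exact: is_derive_cst. Qed.

Lemma half_lineD (R : realType) (y z : R -> R) (t l m : R) :
  is_derive_half_line y t l -> is_derive_half_line z t m ->
  is_derive_half_line (fun s => y s + z s) t (l + m).
Proof.
move=> ly mz; rewrite /is_derive_half_line.
under eq_cvg do rewrite opprD addrACA mulrDl.
exact: cvgD.
Qed.

Lemma half_line_continuous (R : realType) (y : R -> R) (t l : R) :
  is_derive_half_line y t l ->
  y s @[s --> within `[0, +oo[ t^'] --> y t.
Proof.
move=> ly.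
have st0 : (s - t) @[s --> within `[0, +oo[ t^'] --> 0.
  have st : s @[s --> within `[0, +oo[ t^'] --> t.
    by apply: cvg_within_filter; apply: cvg_within_filter; exact: cvg_id.
  by rewrite -[X in _ --> X](subrr t); apply: cvgB => //; exact: cvg_cst.
have : y t + (s - t) * ((y s - y t) / (s - t)) @[s --> within `[0, +oo[ t^'] -->
    y t + 0 * l.
  by apply: cvgD; [exact: cvg_cst|exact: cvgM].
rewrite mul0r addr0; apply: cvg_trans; apply: near_eq_cvg.
have nst : \forall s \near within `[0, +oo[ t^', s != t.
  by apply: (@cvg_within _ t^') => /=; near=> s; near: s; exact: nbhs_dnbhs_neq.
near=> s; have st : s != t by near: s.
by rewrite /= mulrC divfK ?subr_eq0 // addrC subrK.
Unshelve. all: by end_near.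
Qed.

Lemma half_lineM (R : realType) (y z : R -> R) (t l m : R) :
  is_derive_half_line y t l -> is_derive_half_line z t m ->
  is_derive_half_line (fun s => y s * z s) t (l * z t + y t * m).
Proof.
move=> ly mz; rewrite /is_derive_half_line.
have : ((y s - y t) / (s - t)) * z s + y t * ((z s - z t) / (s - t))
    @[s --> within `[0, +oo[ t^'] --> l * z t + y t * m.
  apply: cvgD; first by apply: cvgM => //; exact: half_line_continuous mz.
  by apply: cvgM => //; exact: cvg_cst.
apply: cvg_trans; apply: near_eq_cvg; near=> s.
by rewrite /= mulrAC mulrA -mulrDl; congr (_ / _); ring.
Unshelve. all: by end_near.
Qed.

Lemma half_line_continuous_itv (R : realType) (y F : R -> R) (T : R) :
  solves_half_line y F -> {within `[0, T], continuous y}.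
Proof.
move=> yF; apply/subspace_continuousP => t /=; rewrite in_itv /= => /andP[t0 _].
have yt := @half_line_continuous _ _ _ _ (yF t t0).
move=> P yP.
have : nbhs t [set s | s != t -> `[0, +oo[%classic s -> P (y s)] := yt P yP.
apply: filterS => s /= yPs.
rewrite !in_itv /= andbT in yPs *; move=> /andP[s0 _].
by have [->|st] := eqVneq s t; [exact: nbhs_singleton|exact: yPs].
Qed.

Lemma half_line_expR_comp (R : realType) (h : R -> R) (t dh : R) :
  is_derive t 1 h dh ->
  is_derive_half_line (fun s => expR (h s)) t (dh * expR (h t)).
Proof.
move=> hdh; apply: is_derive_half_line_total; rewrite mulrC.
exact: (is_derive1_comp (is_derive_expR (h t)) hdh).
Qed.

Lemma is_derive_linear (R : realType) (a t : R) :
  is_derive t 1 (fun s : R => a * s) a.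
Proof. by rewrite -[X in is_derive _ _ _ X]mulr1; exact: is_deriveZ. Qed.

Lemma solves_ext (R : realType) (y F G : R -> R) :
  solves_half_line y F -> (forall t : R, 0 <= t -> F t = G t) ->
  solves_half_line y G.
Proof. by move=> yF FG t t0; rewrite -FG//; exact: yF. Qed.

Lemma solvesD (R : realType) (y z F G : R -> R) :
  solves_half_line y F -> solves_half_line z G ->
  solves_half_line (fun t => y t + z t) (fun t => F t + G t).
Proof. by move=> yF zG t t0; apply: half_lineD; [exact: yF|exact: zG]. Qed.

Lemma solvesM (R : realType) (y z F G : R -> R) :
  solves_half_line y F -> solves_half_line z G ->
  solves_half_line (fun t => y t * z t) (fun t => F t * z t + y t * G t).
Proof. by move=> yF zG t t0; apply: half_lineM; [exact: yF|exact: zG]. Qed.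

Lemma solves_cst (R : realType) (k : R) :
  solves_half_line (fun=> k) (fun=> 0).
Proof. by move=> t _; exact: half_line_cst. Qed.

Lemma solvesZ (R : realType) (k : R) (y F : R -> R) :
  solves_half_line y F ->
  solves_half_line (fun t => k * y t) (fun t => k * F t).
Proof.
move=> yF; apply: solves_ext; first exact: solvesM (solves_cst k) yF.
by move=> t _ /=; rewrite mul0r add0r.
Qed.

Lemma solves_expR (R : realType) (a : R) :
  solves_half_line (fun t => expR (a * t)) (fun t => a * expR (a * t)).
Proof. by move=> t _; apply: half_line_expR_comp; exact: is_derive_linear. Qed.

Arguments solves_cst {R} k.
Arguments solvesZ {R} k {y F}.
Arguments solves_expR {R} a.

(** * The comparison principle and its first consequences *)

(** If y were negative somewhere, then y t * exp (- k t), with k > K, would have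
a negative minimum at some c > 0; there its derivative is at least
(K - k) y c exp (- k c) > 0, which contradicts minimality from the left. *)
Lemma nonneg_on_itv (R : realType) (y F : R -> R) (K T : R) :
  solves_half_line y F -> 0 <= y 0 ->
  (forall t : R, 0 <= t <= T -> y t < 0 -> K * y t <= F t) ->
  forall t : R, 0 <= t <= T -> 0 <= y t.
Proof.
move=> yF y0 KF t1 /andP[t10 t1T].
pose k : R := `|K| + 1.
pose w t := y t * expR (- k * t).
pose G t := F t * expR (- k * t) + y t * (- k * expR (- k * t)).
have wG : solves_half_line w G.
  exact: solvesM yF (solves_expR (- k)).
have [c ct wmin] := EVT_min t10 (half_line_continuous_itv (T := t1) wG).
move: ct; rewrite in_itv /= => /andP[c0 ct].
rewrite leNgt; apply/negP => yt1.
have wc : w c < 0.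
  apply: (@le_lt_trans _ _ (w t1)).
    by apply: wmin; rewrite in_itv /= t10 lexx.
  by rewrite /w pmulr_llt0 ?expR_gt0.
have yc : y c < 0 by move: wc; rewrite /w pmulr_llt0 ?expR_gt0.
have cgt0 : 0 < c.
  rewrite lt_neqAle c0 andbT; apply: contraTN yc => /eqP <-.
  by rewrite -leNgt.
(* k > K makes the derivative of w positive at the negative minimum c, while
   the difference quotients to the left of c are nonpositive. *)
have Gc : 0 < G c.
  rewrite /G mulrA -mulrDl; apply: mulr_gt0; last exact: expR_gt0.
  have /KF/(_ yc) Kc : 0 <= c <= T by rewrite c0 (le_trans ct).
  have := ler_norm K; rewrite -/k; rewrite /k; nra.
have near_c : nbhs c [set s | s != c -> `[0, +oo[%classic s ->
    0 < (w s - w c) / (s - c)] := cvgr_gt _ (wG c c0) _ Gc.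
have [e /= e0 He] := (nbhs_ballP _ _).1 (near_c _).
pose s := c - Num.min (e / 2) c.
have m0 : 0 < Num.min (e / 2) c by rewrite lt_min cgt0 andbT divr_gt0.
have s0 : 0 <= s by rewrite subr_ge0 ge_min lexx orbT.
have sc : s < c by rewrite /s; lra.
have : 0 < (w s - w c) / (s - c).
  apply: He; rewrite ?lt_eqF //=; last by rewrite in_itv /= s0.
  rewrite /ball /= /s opprB addrCA subrr addr0 gtr0_norm //.
  by rewrite gt_min; apply/orP; left; lra.
have : w c <= w s by apply: wmin; rewrite in_itv /= s0; lra.
move=> wcs; rewrite ltNge => /negP; apply.
by rewrite nmulr_lle0 ?subr_ge0 // invr_lt0 subr_lt0.
Qed.

Lemma nonneg_solution (R : realType) (y F : R -> R) (K : R) :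
  solves_half_line y F -> 0 <= y 0 ->
  (forall t : R, 0 <= t -> y t < 0 -> K * y t <= F t) ->
  forall t : R, 0 <= t -> 0 <= y t.
Proof.
move=> yF y0 KF t t0; apply: (nonneg_on_itv yF y0 (K := K) (T := t)).
  by move=> s /andP[s0 _]; exact: KF.
by rewrite t0 lexx.
Qed.

Lemma constant_solution (R : realType) (y F : R -> R) :
  solves_half_line y F -> (forall t : R, 0 <= t -> F t = 0) ->
  forall t : R, 0 <= t -> y t = y 0.
Proof.
move=> yF F0 t t0; apply/eqP; rewrite -subr_eq0 eq_le; apply/andP; split.
- have H := solvesD (solves_cst (y 0)) (solvesZ (-1) yF).
  have := nonneg_solution (K := 0) H _ _ t0.
  rewrite mulN1r subrr lexx mulN1r subr_ge0 subr_le0; apply => // s s0 _.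
  by rewrite F0// mul0r mulr0 addr0.
- have H := solvesD yF (solves_cst (- y 0)).
  have := nonneg_solution (K := 0) H _ _ t0.
  rewrite subrr lexx; apply => // s s0 _.
  by rewrite F0// mul0r addr0.
Qed.

Lemma weighted_sum_conserved (R : realType) (y z F G : R -> R) :
  solves_half_line y F -> solves_half_line z G ->
  (forall t : R, 0 <= t -> F t + 2 * G t = 0) ->
  forall t : R, 0 <= t -> y t + 2 * z t = y 0 + 2 * z 0.
Proof.
move=> yF zG FG t t0.
by rewrite (constant_solution (solvesD yF (solvesZ 2 zG))).
Qed.

(** The solution is compared with |y 0| exp (- g t), which solves the equation
with the smaller damping g. *)
Lemma exp_decay_upper (R : realType) (g : R) (b y : R -> R) :
  (forall t : R, 0 <= t -> 0 <= b t) ->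
  solves_half_line y (fun t => - (g + b t) * y t) ->
  forall t : R, 0 <= t -> y t <= `|y 0| * expR (- g * t).
Proof.
move=> b0 yF t t0; rewrite -subr_ge0.
have H := solvesD (solvesZ `|y 0| (solves_expR (- g))) (solvesZ (-1) yF).
have := nonneg_solution (K := - g) H _ _ t0.
rewrite !mulN1r; apply.
  by rewrite mulr0 expR0 mulr1 subr_ge0 ler_norm.
move=> s s0; rewrite !mulN1r subr_lt0 => ys.
have ys0 : 0 <= y s.
  by apply: le_trans (ltW ys); rewrite mulr_ge0 ?expR_ge0.
have := mulr_ge0 (b0 s s0) ys0; lra.
Qed.

Lemma exp_decay (R : realType) (g : R) (b y : R -> R) :
  (forall t : R, 0 <= t -> 0 <= b t) ->
  solves_half_line y (fun t => - (g + b t) * y t) ->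
  forall t : R, 0 <= t -> `|y t| <= `|y 0| * expR (- g * t).
Proof.
move=> b0 yF t t0; rewrite ler_norml; apply/andP; split.
  have nyF : solves_half_line (fun t => -1 * y t)
      (fun t => - (g + b t) * (-1 * y t)).
    by apply: solves_ext (solvesZ (-1) yF) _ => s s0; ring.
  by have := exp_decay_upper b0 nyF t0; rewrite !mulN1r normrN lerNl.
exact: (exp_decay_upper b0 yF).
Qed.

(** * The scalar equations for the mass and the covariance *)

(** Where y is negative the only harmful term of the right-hand side is
- 2 l y ^ 2.  On a compact interval with minimum y c it is at least
- 2 l (y c) y, which the comparison principle tolerates. *)
Lemma riccati_nonneg (R : realType) (l g M : R) (y : R -> R) :
  0 < l -> 0 < g -> 0 < M -> 0 <= y 0 ->
  solves_half_line y (fun t => g * (M - y t) - 2 * l * y t ^+ 2) ->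
  forall t : R, 0 <= t -> 0 <= y t.
Proof.
move=> l0 g0 M0 y0 yF t t0.
have [c _ cmin] := EVT_min t0 (half_line_continuous_itv (T := t) yF).
apply: (nonneg_on_itv yF y0 (K := - 2 * l * y c) (T := t)); last first.
  by rewrite t0 lexx.
move=> s st ys.
have := cmin s; rewrite in_itv /= => /(_ st) cs.
have ys0 : 0 <= - y s by rewrite oppr_ge0 ltW.
have ysc : 0 <= y s - y c by rewrite subr_ge0.
have := mulr_ge0 (ltW l0) (mulr_ge0 ysc ys0).
have := mulr_ge0 (ltW g0) ys0; have := mulr_gt0 g0 M0; lra.
Qed.

(** Subtracting the zero m factors the right-hand side:
(y - m)' = - (g + 2 l (y + m)) (y - m), where y + m is nonnegative. *)
Lemma riccati_converges (R : realType) (l g M y0 : R) :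
  0 < l -> 0 < g -> 0 < M -> 0 <= y0 ->
  exists m, 0 < m /\ forall y : R -> R, y 0 = y0 ->
    solves_half_line y (fun t => g * (M - y t) - 2 * l * y t ^+ 2) ->
    forall t : R, 0 <= t -> `|y t - m| <= `|y0 - m| * expR (- g * t).
Proof.
move=> l0 g0 M0 y00.
pose r := Num.sqrt (g ^+ 2 + 8 * l * g * M).
have lgM : 0 < l * g * M by rewrite !mulr_gt0.
have r2 : r ^+ 2 = g ^+ 2 + 8 * l * g * M.
  by rewrite sqr_sqrtr// addr_ge0 ?sqr_ge0// -!mulrA mulr_ge0// !mulrA ltW.
have gr : g < r.
  by rewrite -(@ltr_pXn2r _ 2)// ?nnegrE ?sqrtr_ge0 ?ltW// r2; lra.
pose m := (r - g) / (4 * l).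
have m0 : 0 < m by rewrite divr_gt0 ?subr_gt0 ?mulr_gt0.
have mE : g * M = g * m + 2 * l * m ^+ 2.
  have rE : r = 4 * l * m + g by rewrite /m; field; lra.
  have : l * (g * M) = l * (g * m + 2 * l * m ^+ 2).
    by move: r2; rewrite rE; lra.
  by apply: mulfI; rewrite gt_eqF.
exists m; split=> // y y0E yF t t0; rewrite -y0E in y00 *.
have y_ge0 : forall s : R, 0 <= s -> 0 <= y s.
  exact: riccati_nonneg l0 g0 M0 y00 yF.
have dF : solves_half_line (fun s => y s + - m)
    (fun s => - (g + 2 * l * (y s + m)) * (y s + - m)).
  apply: solves_ext (solvesD yF (solves_cst (- m))) _ => s s0.
  by rewrite mulrBr mE; ring.
apply: (exp_decay _ dF t0) => s s0.
by rewrite mulr_ge0// ?mulr_ge0 ?addr_ge0 ?y_ge0// ltW.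
Qed.

(** Since the forcing has a sign, |q 0| exp (- g t) bounds q from above.  Below,
the term B exp (- 2 g t), B = l U ^ 2 / g, absorbs the forcing, which decays at
twice the rate of the homogeneous equation. *)
Lemma forced_decay (R : realType) (l g U : R) (u q : R -> R) :
  0 < l -> 0 < g ->
  solves_half_line q (fun t => - g * q t - l * u t ^+ 2) ->
  (forall t : R, 0 <= t -> `|u t| <= U * expR (- g * t)) ->
  forall t : R, 0 <= t -> `|q t| <= (`|q 0| + l * U ^+ 2 / g) * expR (- g * t).
Proof.
move=> l0 g0 qF uU.
have B0 : 0 <= l * U ^+ 2 / g.
  by rewrite divr_ge0 ?(ltW g0) // mulr_ge0 ?sqr_ge0 ?(ltW l0).
have eF := solves_expR (- g).
have upper t : 0 <= t -> 0 <= `|q 0| * expR (- g * t) + -1 * q t.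
  apply: (nonneg_solution (K := - g) (solvesD (solvesZ _ eF) (solvesZ _ qF))).
    by rewrite mulr0 expR0 mulr1 mulN1r subr_ge0 ler_norm.
  by move=> s s0 _; have := mulr_ge0 (ltW l0) (sqr_ge0 (u s)); lra.
set B := l * U ^+ 2 / g in B0 *.
have gB : g * B = l * U ^+ 2 by rewrite /B; field; rewrite gt_eqF.
have lower t : 0 <= t ->
    0 <= q t + ((`|q 0| + B) * expR (- g * t)
      + - B * (expR (- g * t) * expR (- g * t))).
  apply: (nonneg_solution (K := - g) (solvesD qF
    (solvesD (solvesZ _ eF) (solvesZ _ (solvesM eF eF))))).
    have := ler_norm (- q 0); rewrite normrN mulr0 expR0; lra.
  move=> s s0 _; have := uU s s0; set e := expR _ => us.
  have u2 : u s ^+ 2 <= U ^+ 2 * e ^+ 2.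
    rewrite -exprMn -real_normK ?num_real// lerXn2r// nnegrE//.
    exact: le_trans us.
  have := ler_wpM2l (ltW l0) u2; rewrite [X in _ <= X]mulrA -gB; lra.
move=> t t0; have := upper t t0; have := lower t t0.
have := expR_ge0 (- g * t); set e := expR _ => e0.
have := mulr_ge0 B0 e0; have := mulr_ge0 B0 (mulr_ge0 e0 e0).
by rewrite ler_norml => *; apply/andP; split; lra.
Qed.

(** * Exponential decay of the planar system *)

(** The form on the right vanishes only at the origin; quantitatively,
al x = (al x - g y) + g y gives (al x) ^ 2 <= 2 (al x - g y) ^ 2 + 2 (g y) ^ 2,
and al + g <= 1 + al + g absorbs the terms in y. *)
Lemma energy_coercive (R : realType) (al g x y : R) : 0 < al -> 0 < g ->
  2 * al / (1 + al + g) * (al * x ^+ 2 + 2 * g * y ^+ 2) <=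
  4 * (al * x - g * y) ^+ 2 + 4 * g * y ^+ 2.
Proof.
move=> al0 g0.
have s0 : 0 < 1 + al + g by lra.
rewrite mulrAC ler_pdivrMr//.
have := sqr_ge0 (al * x - g * y - g * y).
have := mulr_ge0 (addr_ge0 (ltW al0) (ltW g0)) (sqr_ge0 (al * x - g * y)).
have := mulr_ge0 (ltW g0) (sqr_ge0 y).
lra.
Qed.

(** The bracket is the contribution of a - al to the derivative of the energy;
|4 g x y| <= 2 g (x ^ 2 + y ^ 2) makes it a multiple of the energy. *)
Lemma energy_perturbation (R : realType) (al g x y d D : R) :
  0 < al -> 0 < g -> `|d| <= D ->
  d * (- 4 * al * x ^+ 2 + 4 * g * x * y) <=
  D * (5 + 2 * g / al) * (al * x ^+ 2 + 2 * g * y ^+ 2).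
Proof.
move=> al0 g0 dD.
apply: le_trans (ler_norm _) _; rewrite normrM -[leRHS]mulrA.
apply: ler_pM => //.
have -> : (5 + 2 * g / al) * (al * x ^+ 2 + 2 * g * y ^+ 2) =
    5 * al * x ^+ 2 + 10 * g * y ^+ 2 + 2 * g * x ^+ 2
    + 4 * (g ^+ 2 / al) * y ^+ 2 by field; rewrite gt_eqF.
have := mulr_ge0 (ltW g0) (sqr_ge0 (x - y)).
have := mulr_ge0 (ltW g0) (sqr_ge0 (x + y)).
have := mulr_ge0 (ltW g0) (sqr_ge0 y).
have := mulr_ge0 (ltW al0) (sqr_ge0 x).
have : 0 <= g ^+ 2 / al * y ^+ 2.
  by rewrite mulr_ge0 ?sqr_ge0 // divr_ge0 ?sqr_ge0 ?(ltW al0).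
by rewrite ler_norml => *; apply/andP; split; lra.
Qed.

Lemma sqr_le_energy (R : realType) (al g x y : R) : 0 < al -> 0 < g ->
  (x + 3 * y) ^+ 2 <= (2 / al + 9 / g) * (al * x ^+ 2 + 2 * g * y ^+ 2).
Proof.
move=> al0 g0.
have -> : (2 / al + 9 / g) * (al * x ^+ 2 + 2 * g * y ^+ 2) =
    2 * x ^+ 2 + 18 * y ^+ 2
    + (4 * (g / al) * y ^+ 2 + 9 * (al / g) * x ^+ 2).
  by field; rewrite !gt_eqF.
have := sqr_ge0 (x - 3 * y).
have : 0 <= g / al * y ^+ 2.
  by apply: mulr_ge0; [apply: divr_ge0; exact: ltW|exact: sqr_ge0].
have : 0 <= al / g * x ^+ 2.
  by apply: mulr_ge0; [apply: divr_ge0; exact: ltW|exact: sqr_ge0].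
lra.
Qed.

(** The factor exp (- (k / g) exp (- g t)) integrates the coefficient
k exp (- g t); it lies between exp (- k / g) and 1 when k >= 0, so this
supersolution decays at the rate nu in spite of the perturbation. *)
Lemma supersolution_derive (R : realType) (A nu g k : R) : g != 0 ->
  solves_half_line
    (fun t : R => A * expR (- nu * t + - (k / g) * expR (- g * t)))
    (fun t => (k * expR (- g * t) - nu) *
      (A * expR (- nu * t + - (k / g) * expR (- g * t)))).
Proof.
move=> g0; apply: solves_ext (solvesZ A (_ : solves_half_line _ (fun t =>
    (- nu + - (k / g) * (- g * expR (- g * t))) *
    expR (- nu * t + - (k / g) * expR (- g * t))))) _.
  move=> t t0; apply: half_line_expR_comp.
  apply: is_deriveD; first exact: is_derive_linear.
  apply: is_deriveZ; rewrite mulrC.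
  exact: (is_derive1_comp (is_derive_expR _) (is_derive_linear _ _)).
by move=> t t0; field; exact: g0.
Qed.

Arguments supersolution_derive {R} A nu {g} k.

(** The constants are chosen before the solution, from a bound E0 on its initial
energy.  The rate nu is below the rate rho of the limit system, to leave room
for the forcing, and at most 2 g, the rate at which q ^ 2 decays. *)
Lemma energy_decay (R : realType) (g al D B E0 : R) :
  0 < g -> 0 < al -> 0 <= D ->
  exists A nu, [/\ 0 < A, 0 < nu, nu <= 2 * g &
    forall a x y q : R -> R,
      solves_half_line x (fun t => 2 * g * y t - 2 * a t * x t) ->
      solves_half_line y (fun t => a t * x t - (g + 2) * y t + 2 * q t) ->
      (forall t : R, 0 <= t -> `|a t - al| <= D * expR (- g * t)) ->
      (forall t : R, 0 <= t -> `|q t| <= B * expR (- g * t)) ->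
      al * x 0 ^+ 2 + 2 * g * y 0 ^+ 2 <= E0 ->
      forall t : R, 0 <= t ->
        al * x t ^+ 2 + 2 * g * y t ^+ 2 <= A * expR (- nu * t)].
Proof.
move=> g0 al0 D0.
have s0 : 0 < 1 + al + g by lra.
have g1 : 0 < 1 + g by lra.
pose rho : R := 2 * al / (1 + al + g).
pose nu : R := rho * g / (1 + g).
pose H : R := D * (5 + 2 * g / al).
(* S exp (- nu t) is the size of a supersolution that dominates the forcing;
   the factor exp (H / g) compensates the least value of the integrating
   factor. *)
pose S : R := 4 * g * B ^+ 2 / (rho - nu).
pose A : R := expR (H / g) * (`|E0| + S + 1).
have rho0 : 0 < rho by rewrite divr_gt0 ?mulr_gt0.
have nu0 : 0 < nu by apply: divr_gt0 => //; exact: mulr_gt0.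
have rnE : rho - nu = rho / (1 + g) by rewrite /nu; field; lra.
have rn0 : 0 < rho - nu by rewrite rnE divr_gt0.
have rho2 : rho <= 2 by rewrite ler_pdivrMr//; lra.
have nug : nu <= 2 * g.
  rewrite ler_pdivrMr//.
  have := mulr_ge0 (ltW g0) (_ : 0 <= 2 - rho); rewrite subr_ge0 => /(_ rho2).
  have := mulr_gt0 g0 g0; lra.
have H0 : 0 <= H.
  by rewrite mulr_ge0// addr_ge0// divr_ge0 ?(ltW al0)// mulr_ge0 ?(ltW g0).
have S0 : 0 <= S.
  by rewrite divr_ge0 ?(ltW rn0)// mulr_ge0 ?sqr_ge0// mulr_ge0 ?(ltW g0).
have A0 : 0 < A by rewrite mulr_gt0 ?expR_gt0// ltr_wpDl// addr_ge0.
exists A, nu; split=> // a x y q xF yF aD qB E0E.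
pose E t : R := al * x t ^+ 2 + 2 * g * y t ^+ 2.
pose z t : R := A * expR (- nu * t + - (H / g) * expR (- g * t)).
have zF := supersolution_derive A nu H (lt0r_neq0 g0).
have EF := solvesD (solvesZ al (solvesM xF xF))
  (solvesZ (2 * g) (solvesM yF yF)).
have e1 t : 0 <= t -> expR (- g * t) <= 1.
  by move=> t0; rewrite -expR0 ler_expR mulNr oppr_le0 mulr_ge0 ?(ltW g0).
have z_ge t : 0 <= t -> (`|E0| + S + 1) * expR (- nu * t) <= z t.
  move=> t0.
  have one_le : 1 <= expR (H / g) * expR (- (H / g) * expR (- g * t)).
    rewrite -expRD -expR0 ler_expR mulNr -[X in X - _]mulr1 -mulrBr.
    by rewrite mulr_ge0 ?divr_ge0 ?(ltW g0) ?subr_ge0 ?e1.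
  have -> : z t = (`|E0| + S + 1) * expR (- nu * t) *
      (expR (H / g) * expR (- (H / g) * expR (- g * t))).
    by rewrite /z /A expRD; ring.
  by rewrite ler_peMr// mulr_ge0 ?expR_ge0// !addr_ge0.
have zE t : 0 <= t -> 0 <= z t + -1 * E t.
  apply: (nonneg_solution (K := H) (solvesD zF (solvesZ (-1) EF))).
    have := z_ge 0 (lexx 0); rewrite -/(z 0) mulr0 expR0 mulr1.
    by have := ler_norm E0; move: E0E; lra.
  move=> s s_ge0; rewrite -/(z s) /E => wneg.
  have coer := energy_coercive (x s) (y s) al0 g0; rewrite -/rho in coer.
  have pert := energy_perturbation (x s) (y s) al0 g0 (aD s s_ge0).
  have := z_ge s s_ge0; have := e1 s s_ge0; have := qB s s_ge0.
  have : expR (- g * s) ^+ 2 <= expR (- nu * s).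
    rewrite expr2 -expRD ler_expR; have := mulr_ge0 s_ge0 (_ : 0 <= 2 * g - nu).
    by rewrite subr_ge0 => /(_ nug); lra.
  have := expR_ge0 (- g * s); set e := expR (- g * s) in pert *.
  set en := expR (- nu * s) => e_ge0 e_en qs e_le1 zs.
  have SE : (rho - nu) * S = 4 * g * B ^+ 2 by rewrite /S mulrC divfK ?gt_eqF.
  have q2 : q s ^+ 2 <= B ^+ 2 * e ^+ 2.
    rewrite -exprMn -real_normK ?num_real// lerXn2r// nnegrE//.
    exact: le_trans qs.
  have forcing : 4 * g * q s ^+ 2 <= (rho - nu) * z s.
    apply: (@le_trans _ _ (4 * g * B ^+ 2 * en)).
      have := ler_wpM2l (sqr_ge0 B) e_en => Be.
      by have := ler_wpM2l (ltW g0) (le_trans q2 Be); lra.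
    rewrite -SE -mulrA ler_pM2l// (le_trans _ zs)// ler_wpM2r ?expR_ge0//.
    by have := normr_ge0 E0; lra.
  have young := mulr_ge0 (ltW g0) (sqr_ge0 (y s - q s)).
  (* Where z < E, the coefficient H e - rho of the difference z - E may be
     replaced by the constant H. *)
  have He : 0 <= (H * (1 - e) + rho) *
      - (z s + -1 * (al * x s ^+ 2 + 2 * g * y s ^+ 2)).
    rewrite mulr_ge0 ?oppr_ge0 ?(ltW wneg)// addr_ge0 ?(ltW rho0)//.
    by rewrite mulr_ge0// subr_ge0.
  have pert' : (a s - al) * (- 4 * al * x s ^+ 2 + 4 * g * x s * y s) <=
      H * e * (al * x s ^+ 2 + 2 * g * y s ^+ 2).
    by apply: le_trans pert _; rewrite /H [D * _ * e]mulrAC.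
  move: young He pert' coer forcing; rewrite -/(z s); lra.
move=> t t0; apply: (@le_trans _ _ (z t)).
  by have := zE t t0; rewrite mulN1r subr_ge0.
rewrite ler_pM2l// ler_expR gerDl mulNr oppr_le0.
by rewrite mulr_ge0 ?expR_ge0// divr_ge0 ?(ltW g0).
Qed.

Unset Implicit Arguments.

(** * Decay of the variances *)

Theorem lemma1 (R : realType) (lambda gamma : R)
    (lambda_gt0 : 0 < lambda) (gamma_gt0 : 0 < gamma)
    (f0 : R -> R) (g0 : R * R -> R)
    (f0_adm : admissible_f f0) (g0_adm : admissible_g g0)
    (M_gt0 : 0 < mass f0 g0)
    (Mf Mg If Ig : R -> R)
    (M_sol : mass_system lambda gamma Mf Mg)
    (Mf_init : Mf 0 = Mf0 f0) (Mg_init : Mg 0 = Mg0 g0)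
    (I_sol : moment_system lambda gamma Mf If Ig)
    (If_init : If 0 = If0 f0) (Ig_init : Ig 0 = Ig0 g0) :
  exists C mu : R, [/\ 0 < C, 0 < mu &
    forall Vf Vg Vbarg : R -> R,
      variance_system lambda gamma (phi_inf f0 g0) Mf If Vf Vg Vbarg ->
      Vf 0 = Vf0 f0 g0 -> Vg 0 = Vg0 f0 g0 -> Vbarg 0 = Vbarg0 g0 ->
      forall t : R, 0 <= t -> Vf t + Vg t + Vbarg t <= C * expR (- mu * t)].
Proof.
have Mf0_ge0 : 0 <= Mf 0.
  by rewrite Mf_init; apply: Rintegral_ge0 => x _; case: f0_adm.
case: M_sol => MfF MgF; case: I_sol => IfF IgF.
set M := mass f0 g0 in M_gt0; set phi := phi_inf f0 g0.
have Mcons (t : R) : 0 <= t -> Mf t + 2 * Mg t = M.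
  move=> t0; rewrite (weighted_sum_conserved MfF MgF) //.
    by rewrite Mf_init Mg_init.
  by move=> s _; ring.
have Icons (t : R) : 0 <= t -> If t + 2 * Ig t = phi * M.
  move=> t0; rewrite (weighted_sum_conserved IfF IgF) //.
    by rewrite If_init Ig_init /phi /phi_inf divfK // gt_eqF.
  by move=> s _; ring.
have MfR : solves_half_line Mf
    (fun t => gamma * (M - Mf t) - 2 * lambda * Mf t ^+ 2).
  by apply: solves_ext MfF _ => t t0; rewrite -(Mcons t t0); ring.
have Mf_ge0 := riccati_nonneg lambda_gt0 gamma_gt0 M_gt0 Mf0_ge0 MfR.
have [m [m0 /(_ Mf erefl MfR) Mfm]] :=
  riccati_converges lambda_gt0 gamma_gt0 M_gt0 Mf0_ge0.
pose u t : R := If t + - phi * Mf t.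
have uF : solves_half_line u (fun t => - (gamma + 2 * lambda * Mf t) * u t).
  apply: solves_ext (solvesD IfF (solvesZ (- phi) MfF)) _ => t t0.
  have -> : 2 * gamma * Ig t = gamma * (phi * M - If t).
    by rewrite -(Icons t t0); ring.
  by rewrite -(Mcons t t0) /u; ring.
have u_dec : forall t : R, 0 <= t -> `|u t| <= `|u 0| * expR (- gamma * t).
  apply: exp_decay uF => t t0.
  by rewrite mulr_ge0 ?Mf_ge0// mulr_ge0 // ltW.
pose al : R := lambda * m.
have al0 : 0 < al by rewrite mulr_gt0.
pose D : R := lambda * `|Mf 0 - m|.
have D0 : 0 <= D by rewrite mulr_ge0 // ltW.
pose B : R := `|Vg0 f0 g0 + - (1/2) * Vbarg0 g0| + lambda * `|u 0| ^+ 2 / gamma.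
have [A [nu [A0 nu0 nug decay]]] := energy_decay B
  (al * Vf0 f0 g0 ^+ 2 + 2 * gamma * Vg0 f0 g0 ^+ 2) gamma_gt0 al0 D0.
(* (Vf + 3 Vg) ^ 2 <= (Q - 1) exp (- nu t), and Q - 1 <= Q ^ 2. *)
pose Q : R := 1 + (2 / al + 9 / gamma) * A.
have Q1 : 1 <= Q.
  by rewrite lerDl mulr_ge0 ?(ltW A0)// addr_ge0// divr_ge0 ?(ltW al0)// ltW.
have B0 : 0 <= B.
  by rewrite addr_ge0// divr_ge0 ?(ltW gamma_gt0)// mulr_ge0 ?sqr_ge0// ltW.
(* The rate is halved because the energy is quadratic. *)
exists (Q + 2 * B), (nu / 2); split; [lra|lra|].
move=> Vf Vg Vb [VfF VgF VbF] Vf_init Vg_init Vb_init t t0.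
pose q t : R := Vg t + - (1/2) * Vb t.
have qF : solves_half_line q (fun t => - gamma * q t - lambda * u t ^+ 2).
  apply: solves_ext (solvesD VgF (solvesZ (- (1/2)) VbF)) _ => s s0.
  by rewrite /q /u; field.
have q_dec := forced_decay lambda_gt0 gamma_gt0 qF u_dec.
have q0 : `|q 0| + lambda * `|u 0| ^+ 2 / gamma = B.
  by rewrite /q Vg_init Vb_init.
rewrite q0 in q_dec.
have := decay (fun t => lambda * Mf t) Vf Vg q.
rewrite Vf_init Vg_init lexx => /(_ _ _ _ q_dec isT t t0) Edec.
have {}Edec : al * Vf t ^+ 2 + 2 * gamma * Vg t ^+ 2 <= A * expR (- nu * t).
  apply: Edec.
  - by apply: solves_ext VfF _ => s s0; ring.
  - by apply: solves_ext VgF _ => s s0; rewrite /q; field.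
  - move=> s s0; rewrite -mulrBr normrM gtr0_norm// -mulrA.
    by rewrite ler_pM2l// Mfm.
have qt := q_dec t t0.
set e := expR (- (nu / 2) * t).
have e0 : 0 < e by exact: expR_gt0.
have eE : expR (- nu * t) = e ^+ 2.
  by rewrite expr2 -expRD; congr expR; lra.
have eg : expR (- gamma * t) <= e.
  rewrite ler_expR; have := mulr_ge0 t0 (_ : 0 <= 2 * gamma - nu).
  by rewrite subr_ge0 => /(_ nug); lra.
have Vle : Vf t + 3 * Vg t <= Q * e.
  apply: le_trans (ler_norm _) _.
  rewrite -(@ler_pXn2r _ 2)// ?nnegrE// ?mulr_ge0 ?(ltW e0) //; last lra.
  rewrite real_normK ?num_real// exprMn -eE.
  apply: (le_trans (sqr_le_energy _ _ al0 gamma_gt0)).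
  apply: (@le_trans _ _ ((Q - 1) * expR (- nu * t))).
    have -> : Q - 1 = (2 / al + 9 / gamma) * A by rewrite /Q; ring.
    rewrite -[leRHS]mulrA; apply: ler_wpM2l => //.
    by apply: addr_ge0; apply: divr_ge0 => //; exact: ltW.
  rewrite ler_wpM2r ?expR_ge0//.
  have := mulr_ge0 (_ : 0 <= Q - 1) (_ : 0 <= Q - 1).
  rewrite subr_ge0 => /(_ Q1 Q1); lra.
have := ler_norm (- q t); rewrite normrN => qn.
have := le_trans qt (ler_wpM2l B0 eg); rewrite {1}/q in qn.
lra.
Qed.
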